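(* Let $X$ be an infinite-dimensional complex Banach space and let $\phi : \mathcal{B}(X) \to \mathcal{B}(X)$ be a surjective map (not assumed linear or continuous) satisfying $$\dim F(ST) = \dim F(\phi(S)\phi(T)) \quad \text{for all } S, T \in \mathcal{B}(X).$$ Let $A, B \in \mathcal{F}_1(X)$. Then $A \sim B$ if and only if $\phi(A) \sim \phi(B)$.
   Context: $\mathcal{B}(X)$ is the algebra of all bounded linear operators on $X$, and $X^*$ is the dual space of $X$. For $x \in X$ and $f \in X^*$, $x \otimes f \in \mathcal{B}(X)$ is the operator of rank at most one defined by $(x \otimes f)z = f(z)x$ for $z \in X$. $\mathcal{F}_1(X)$ is the set of all operators in $\mathcal{B}(X)$ of rank at most one. For $T \in \mathcal{B}(X)$, $F(T) = \{x \in X : Tx = x\}$ is the subspace of fixed points of $T$, and $\dim F(T)$ is its dimension. For $x, y \in X$ and $f, g \in X^*$, one writes $x \otimes f \sim y \otimes g$ if $x$ and $y$ are linearly dependent or $f$ and $g$ are linearly dependent; thus for operators $C, D \in \mathcal{B}(X)$, $C \sim D$ means that $C = x \otimes f$ and $D = y \otimes g$ for some $x, y \in X$, $f, g \in X^*$ such that $x, y$ are linearly dependent or $f, g$ are linearly dependent. *)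

(* Defs.v *)
From HB Require Import structures.
From mathcomp Require Export all_boot all_order all_algebra.
From mathcomp Require Export all_classical all_reals all_analysis.
From mathcomp Require Export complex.
Export Order.TTheory GRing.Theory Num.Theory.
Export numFieldNormedType.Exports.

Set Implicit Arguments.
Unset Strict Implicit.
Unset Printing Implicit Defensive.

Local Open Scope classical_set_scope.
Local Open Scope ring_scope.

Section Dimension.
Context {K : fieldType} {V : lmodType K}.
Implicit Types (B W : set V).

Definition lin_indep B :=
  forall (s : seq V) (c : V -> K), uniq s -> [set` s] `<=` B ->
    \sum_(v <- s) c v *: v = 0 -> forall v, v \in s -> c v = 0.

Definition lin_span B : set V :=
  [set w | exists (s : seq V) (c : V -> K),
     [set` s] `<=` B /\ w = \sum_(v <- s) c v *: v].

Definition is_basis W B := lin_indep B /\ lin_span B = W.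

(* The dimension as a cardinal number in the sense of Frege: the class of all
   subsets of [V] that are equipotent to some (Hamel) basis of [W].  Thus
   [dim W1 = dim W2] says that bases of [W1] and [W2] have the same, possibly
   infinite, cardinality. *)
Definition dim W : set (set V) :=
  [set C | exists2 B, is_basis W B & (B #= C)%card].

Definition dim_le (W : set V) (n : nat) := exists2 C, dim W C & (C #<= `I_n)%card.

Definition finite_dim (W : set V) := exists n, dim_le W n.

(* Linear dependence of the family [(v, w)]; it holds in particular if
   [v = w]. *)
Definition lin_dep (v w : V) :=
  exists a b : K, (a, b) <> (0, 0) /\ a *: v + b *: w = 0.

End Dimension.

Definition bounded_op {K : numFieldType} {X Y : normedModType K} (f : X -> Y) :=
  exists M : K, forall x, `|f x| <= M * `|x|.

Record bounded_linear {K : numFieldType} (X Y : normedModType K) := BoundedLinear {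
  blfun :> {linear X -> Y};
  blfunP : bounded_op blfun }.

Notation "''B' ( X )" := (bounded_linear X X)
  (at level 8, format "''B' ( X )") : type_scope.

Definition dual {K : numFieldType} (X : normedModType K) :=
  bounded_linear X K^o.

Section Operators.
Context {K : numFieldType}.

Lemma bounded_linear_ext (X Y : normedModType K) (f g : bounded_linear X Y) :
  (forall x, f x = g x) -> f = g.
Proof.
case: f g => [[f [[f1] [f2]]] fP] [[g [[g1] [g2]]] gP] /= fg.
have e : f = g by apply/funext.
subst g; rewrite (Prop_irrelevance g1 f1) (Prop_irrelevance g2 f2) in gP *.
by rewrite (Prop_irrelevance gP fP).
Qed.

Lemma bounded_op_ge0 (X Y : normedModType K) (f : X -> Y) :
  bounded_op f -> exists2 M : K, 0 <= M & forall x, `|f x| <= M * `|x|.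
Proof.
case=> M fM; have [[x x0]|x0] := pselect (exists x : X, x != 0).
  exists M => //; have n0 : 0 < `|x| by rewrite normr_gt0.
  by rewrite -(pmulr_lge0 _ n0) (le_trans _ (fM x)).
exists 0 => // x; have -> : x = 0.
  by apply: contrapT => /eqP xN0; apply: x0; exists x.
by rewrite mul0r (le_trans (fM 0)) // normr0 mulr0.
Qed.

Lemma bl_comp_bounded (X Y Z : normedModType K) (S : bounded_linear Y Z)
  (T : bounded_linear X Y) : bounded_op (S \o T).
Proof.
have [M M0 SM] := bounded_op_ge0 (blfunP S).
have [N N0 TN] := bounded_op_ge0 (blfunP T).
exists (M * N) => x /=; apply: le_trans (SM _) _.
by rewrite -mulrA ler_wpM2l.
Qed.

Definition bl_comp (X Y Z : normedModType K) (S : bounded_linear Y Z)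
    (T : bounded_linear X Y) : bounded_linear X Z :=
  BoundedLinear (blfun := S \o T : {linear X -> Z}) (bl_comp_bounded S T).

Context {X : normedModType K}.

Definition rank1_fun (x : X) (f : dual X) : X -> X := fun z => (f z : K) *: x.

Lemma rank1_fun_linear (x : X) (f : dual X) : linear (rank1_fun x f).
Proof.
by move=> a u v; rewrite /rank1_fun linearP /= scalerDl scalerA.
Qed.

HB.instance Definition _ (x : X) (f : dual X) :=
  GRing.isLinear.Build K X X *:%R (rank1_fun x f) (rank1_fun_linear x f).

Lemma rank1_fun_bounded (x : X) (f : dual X) : bounded_op (rank1_fun x f).
Proof.
case: (blfunP f) => M fM; exists (M * `|x|) => z.
by rewrite /rank1_fun normrZ mulrAC ler_wpM2r// fM.
Qed.

Definition rank1 (x : X) (f : dual X) : 'B(X) :=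
  BoundedLinear (blfun := rank1_fun x f : {linear X -> X})
    (rank1_fun_bounded x f).

Definition rank_le1 : set 'B(X) := [set T | dim_le (range T) 1].

Definition fixedpts (T : 'B(X)) : set X := [set x | T x = x].

Definition op_sim (C D : 'B(X)) :=
  exists (x y : X) (f g : dual X),
    [/\ C = rank1 x f, D = rank1 y g &
        lin_dep x y \/ lin_dep (f : X -> K^o) (g : X -> K^o)].

End Operators.

(* Main.v *)
From HB Require Import structures.
From mathcomp Require Import ring.
Require Import Defs.

Set Implicit Arguments.
Unset Strict Implicit.
Unset Printing Implicit Defensive.

Local Open Scope classical_set_scope.
Local Open Scope ring_scope.

(* For [A = x ⊗ f], the operator [T A] has a nonzero fixed point iff
   [f (T x) = 1]; let [H A] be the set of these [T].  By Hahn-Banach, [A] has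
   rank at most one iff [dim F(T A) <= 1] for all [T], and then [H A] determines
   [A].  Moreover, for [A], [B] of rank at most one, [A ~ B] iff [A = B] or some
   [C] of rank at most one, different from [A] and [B], satisfies
   [H A ∩ H B ⊆ H C]: if [A ~ B], take the midpoint [C = (A + B) / 2];
   otherwise the inclusion puts [C] on the affine line through [A] and [B],
   where only [A] and [B] have rank at most one.  All these conditions are
   preserved by [phi]. *)

(** * The Hahn-Banach theorem *)

Section HahnBanach.
Context {R : realType} {V : lmodType R}.
Implicit Types (p q : V -> R) (x y z : V).

Definition sublinear p :=
  (forall x y, p (x + y) <= p x + p y) /\
  (forall (a : R) x, 0 <= a -> p (a *: x) <= a * p x).

Lemma sublinear0 p : sublinear p -> p 0 = 0.
Proof.
case=> pD pZ; apply/eqP; rewrite eq_le; apply/andP; split.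
  by have := pZ 0 0 (lexx 0); rewrite scale0r mul0r.
by have := pD 0 0; rewrite addr0 lerDl.
Qed.

Lemma sublinearN_ge p x : sublinear p -> - p (- x) <= p x.
Proof.
move=> sp; have := sp.1 x (- x).
by rewrite subrr (sublinear0 sp) -lerBlDr sub0r.
Qed.

(** For $a > 0$ the reverse inequality is the assumed one for the scalar $a^{-1}$ at $ax$. *)
Lemma sublinearZ p (a : R) x : sublinear p -> 0 <= a -> p (a *: x) = a * p x.
Proof.
move=> sp; rewrite le_eqVlt => /predU1P[<-|a0].
  by rewrite scale0r mul0r sublinear0.
apply/eqP; rewrite eq_le sp.2 ?(ltW a0)//= -ler_pdivlMl//.
rewrite -[X in p X <= _](scalerK (lt0r_neq0 a0)).
by rewrite sp.2// invr_ge0 ltW.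
Qed.

(* The index conditions hold both for a chain of sublinear functionals and for
   the difference quotients used in [sublinear_directional]. *)
Lemma sublinear_inf (I : Type) (D : set I) (F : I -> V -> R) :
    D !=set0 ->
    (forall x, has_lbound [set F i x | i in D]) ->
    (forall i j, D i -> D j ->
       exists2 k, D k & forall x y, F k (x + y) <= F i x + F j y) ->
    (forall i (a : R), D i -> 0 <= a ->
       exists2 k, D k & forall x, F k (a *: x) <= a * F i x) ->
  sublinear (fun x => inf [set F i x | i in D]) /\
  (forall i x, D i -> inf [set F i x | i in D] <= F i x).
Proof.
move=> [i0 Di0] lbF FD FZ.
have infF i x : D i -> inf [set F i x | i in D] <= F i x.
  by move=> Di; apply: ge_inf => //; exists i.
have F0 x : [set F i x | i in D] !=set0 by exists (F i0 x), i0.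
split => //; split=> [x y|a x a0].
  rewrite -lerBlDr; apply: lb_le_inf => // _ [i Di <-].
  rewrite lerBlDr -lerBlDl; apply: lb_le_inf => // _ [j Dj <-].
  have [k Dk Fk] := FD i j Di Dj.
  by rewrite lerBlDl (le_trans (infF k _ Dk)).
move: (a0); rewrite le_eqVlt => /predU1P[a_eq0|a_gt0].
  have [k Dk Fk] := FZ i0 a Di0 a0.
  by rewrite (le_trans (infF k _ Dk))// (le_trans (Fk _))// -a_eq0 !mul0r.
rewrite -ler_pdivrMl//; apply: lb_le_inf => // _ [i Di <-].
have [k Dk Fk] := FZ i a Di a0.
by rewrite ler_pdivrMl// (le_trans (infF k _ Dk)).
Qed.

(** Take $q(x) = \inf_{t \ge 0} (p(x + tz) - t p(z))$; $t = 0$ gives $q \le p$, and $t = 1$ at $-z$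
    gives the last bound. *)
Lemma sublinear_directional p z : sublinear p ->
  exists2 q, sublinear q & (forall x, q x <= p x) /\ q (- z) <= - p z.
Proof.
move=> sp; have [pD pZ] := sp.
pose F (t : R) x := p (x + t *: z) - t * p z.
have [||||sq Fq] := @sublinear_inf _ [set t : R | 0 <= t] F.
- by exists 0 => /=.
(* Lower bound: $t p(z) = p(tz) \le p(x + tz) + p(-x)$. *)
- move=> x; exists (- p (- x)) => _ [t /= t0 <-].
  rewrite /F lerBrDr addrC lerBlDr -(sublinearZ _ sp)//.
  by apply: le_trans (pD _ _); rewrite addrAC subrr add0r.
- move=> s t /= s0 t0; exists (s + t) => /= [|x y]; first exact: addr_ge0.
  rewrite /F scalerDl addrACA mulrDl opprD [leRHS]addrACA lerD2r.
  exact: pD.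
- move=> t a /= t0 a0; exists (a * t) => /= [|x]; first exact: mulr_ge0.
  by rewrite /F -scalerA -scalerDr mulrBr mulrA lerD2r pZ.
exists (fun x => inf [set F i x | i in [set t : R | 0 <= t]]) => //; split.
  move=> x; apply: le_trans (Fq 0 x _) _ => //=.
  by rewrite /F scale0r addr0 mul0r subr0.
apply: le_trans (Fq 1 _ _) _ => //=.
by rewrite /F scale1r addNr (sublinear0 sp) mul1r sub0r.
Qed.

(** By minimality the functional of [sublinear_directional] is [q] itself, so [q] is odd. Oddness
    turns subadditivity into additivity and extends homogeneity to negative scalars. *)
Lemma minimal_sublinear_linear q : sublinear q ->
    (forall q', sublinear q' -> (forall x, q' x <= q x) -> q' = q) ->
  scalar q.
Proof.
move=> sq minq; have qN z : q (- z) = - q z.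
  have [q' sq' [q'q q'z]] := sublinear_directional z sq.
  rewrite (minq _ sq' q'q) in q'z.
  by apply/eqP; rewrite eq_le q'z lerNl sublinearN_ge.
have qD x y : q (x + y) = q x + q y.
  apply/eqP; rewrite eq_le sq.1/= -lerBrDr.
  by have := sq.1 (x + y) (- y); rewrite addrK qN.
move=> a x y; rewrite qD; congr (_ + _).
have [a0|/ltW a0] := leP 0 a; first by rewrite (sublinearZ _ sq a0).
by rewrite -[a]opprK scaleNr qN (sublinearZ _ sq) ?oppr_ge0// -mulNr.
Qed.

Lemma exists_minimal_sublinear p : sublinear p ->
  exists2 q, sublinear q /\ (forall x, q x <= p x) &
    forall q', sublinear q' -> (forall x, q' x <= q x) -> q' = q.
Proof.
move=> sp; pose Q q := sublinear q /\ forall x, q x <= p x; pose T := sig Q.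
(* The pointwise order is reversed: maximal elements for [below] are minimal functionals. *)
pose below (r s : T) := `[< forall x, sval s x <= sval r x >].
have T_eq (r s : T) : sval r = sval s -> r = s.
  case: r s => [r rP] [s sP] /= rs; subst s.
  by rewrite (Prop_irrelevance rP sP).
have [||||t mint] := @Zorn T below.
- by move=> t; apply/asboolP.
- move=> r s t /asboolP rs /asboolP st; apply/asboolP => x.
  exact: le_trans (st x) (rs x).
- move=> r s /asboolP rs /asboolP sr; apply/T_eq/funext => x.
  by apply/eqP; rewrite eq_le rs sr.
- move=> A totA; have [[r0 Ar0]|A0] := pselect (A !=set0); last first.
    by exists (exist Q p (conj sp (fun=> lexx _))) => s As; case: A0; exists s.
  have [||||sq Aq] := @sublinear_inf _ A (fun r => sval r).
  + by exists r0.
  (* For every [r] in the chain, $-p(-x) \le -r(-x) \le r(x)$. *)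
  + move=> x; exists (- p (- x)) => _ [r Ar <-].
    have [sr rp] := svalP r.
    by apply: le_trans (sublinearN_ge x sr); rewrite lerN2.
  + move=> r s Ar As.
    have [rs|sr] := totA r s Ar As.
      exists s => // x y; apply: le_trans ((svalP s).1.1 x y) _.
      by rewrite lerD2r; move/asboolP : rs.
    exists r => // x y; apply: le_trans ((svalP r).1.1 x y) _.
    by rewrite lerD2l; move/asboolP : sr.
  + by move=> r a Ar a0; exists r => // x; exact: (svalP r).1.2.
  have qp x : inf [set sval r x | r in A] <= p x.
    exact: le_trans (Aq _ x Ar0) ((svalP r0).2 x).
  exists (exist Q _ (conj sq qp)) => s As; apply/asboolP => x /=.
  exact: Aq.
case: t mint => q [sq qp] minq.
exists q => // q' sq' q'q.
have q'p x : q' x <= p x by exact: le_trans (q'q x) (qp x).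
apply: (congr1 sval (minq (exist Q q' (conj sq' q'p)) _)).
exact/asboolP.
Qed.

(** A linear $u$ below the directional functional $p'$ satisfies $-u(z) = u(-z) \le p'(-z) \le
    -p(z)$, hence $u(z) \ge p(z)$. *)
Theorem hahn_banach_support p z : sublinear p ->
  exists u : V -> R, [/\ scalar u, forall x, u x <= p x & u z = p z].
Proof.
move=> sp; have [p' sp' [p'p p'z]] := sublinear_directional z sp.
have [u [su up'] minu] := exists_minimal_sublinear sp'.
have lu := minimal_sublinear_linear su minu.
exists u; split=> // [x|]; first exact: le_trans (up' x) (p'p x).
apply/eqP; rewrite eq_le (le_trans (up' z))//= -lerN2.
apply: le_trans p'z; apply: le_trans (up' _).
have := lu (- 1) z 0.
by rewrite addr0 (sublinear0 su) addr0 scaleN1r mulN1r => ->.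
Qed.

End HahnBanach.

(** An alias, so that the real module structure does not clash with the complex one on [V]. *)
Definition restrict_scalars (R : realType) (V : lmodType R[i]) : Type := V.

(** * Linear combinations of bounded operators *)

Section LinearCombination.
Context {K : numFieldType} {X Y : normedModType K}.
Variables (a : K) (S : bounded_linear X Y) (b : K) (T : bounded_linear X Y).

Definition lincomb_fun : X -> Y := fun x => a *: S x + b *: T x.

Lemma lincomb_fun_linear : linear lincomb_fun.
Proof.
move=> c x y; rewrite /lincomb_fun (linearP S) (linearP T) /=.
by rewrite !scalerDr !scalerA addrACA ![_ * c]mulrC.
Qed.

HB.instance Definition _ :=
  GRing.isLinear.Build K X Y *:%R lincomb_fun lincomb_fun_linear.

Lemma lincomb_fun_bounded : bounded_op lincomb_fun.
Proof.
case: (blfunP S) (blfunP T) => [M SM] [N TN].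
exists (`|a| * M + `|b| * N) => x; rewrite mulrDl -!mulrA.
apply: le_trans (ler_normD _ _) _; rewrite !normrZ.
by apply: lerD; apply: ler_wpM2l.
Qed.

Definition bl_lincomb : bounded_linear X Y :=
  BoundedLinear (blfun := lincomb_fun : {linear X -> Y}) lincomb_fun_bounded.

Lemma bl_lincombE x : bl_lincomb x = a *: S x + b *: T x.
Proof. by []. Qed.

End LinearCombination.

(** * Restriction to real scalars *)

Section RestrictScalars.
Context {R : realType} {V : lmodType R[i]}.
Local Notation VR := (restrict_scalars V).

HB.instance Definition _ := GRing.Zmodule.on VR.

Let rscale (a : R) (v : VR) : VR := (a%:C%C *: (v : V)).

Let rscaleA a b v : rscale a (rscale b v) = rscale (a * b) v.
Proof. by rewrite /rscale scalerA -rmorphM. Qed.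

Let rscale1 : left_id 1 rscale.
Proof. by move=> v; rewrite /rscale rmorph1 scale1r. Qed.

Let rscaleDr : right_distributive rscale +%R.
Proof. by move=> a u v; rewrite /rscale scalerDr. Qed.

Let rscaleDl v : {morph rscale^~ v : a b / a + b}.
Proof. by move=> a b; rewrite /rscale rmorphD scalerDl. Qed.

HB.instance Definition _ :=
  GRing.Zmodule_isLmodule.Build R VR rscaleA rscale1 rscaleDr rscaleDl.

Lemma restrict_scalarsE (a : R) (v : VR) : a *: v = a%:C%C *: (v : V).
Proof. by []. Qed.

End RestrictScalars.

(** * The complex Hahn-Banach theorem *)

Section ComplexHahnBanach.
Context {R : realType}.

Lemma normc_real (a : R) : `|a%:C%C| = `|a|%:C%C :> R[i].
Proof. by rewrite normc_def /= expr0n addr0 sqrtr_sqr. Qed.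

Lemma normc_i : `|'i%C| = 1 :> R[i].
Proof. by rewrite normc_def /= expr0n add0r expr1n sqrtr1. Qed.

(** The usual formula $u(x) - i u(ix)$ for the complex-linear functional with real part $u$. *)
Definition complexification (V : lmodType R[i]) (u : V -> R) (x : V) : R[i] :=
  (u x +i* - u ('i%C *: x))%C.

Lemma complexification_linear (V : lmodType R[i])
    (u : restrict_scalars V -> R) :
  scalar u -> scalar (complexification (u : V -> R)).
Proof.
move=> ul; have u0 : u 0 = 0.
  by have := ul (- 1) 0 0; rewrite scaler0 addr0 mulN1r addNr.
have uD (v w : V) : u (v + w) = u v + u w.
  by have := ul 1 v w; rewrite scale1r mul1r.
have uZ (a : R) (v : V) : u (a%:C%C *: v) = a * u v.
  by have := ul a v 0; rewrite restrict_scalarsE addr0 u0 addr0.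
have uN (v : V) : u (- v) = - u v.
  by rewrite -mulN1r -uZ rmorphN1 scaleN1r.
have uZc (a b : R) (v : V) :
    u ((a +i* b)%C *: v) = a * u v + b * u ('i%C *: v).
  rewrite [(a +i* b)%C]complexE /= scalerDl uD uZ; congr (_ + _).
  by rewrite mulrC -scalerA uZ.
move=> [a b] v w; rewrite /complexification.
have -> : 'i%C *: ((a +i* b)%C *: v + w) =
    (- b +i* a)%C *: v + 'i%C *: w.
  rewrite scalerDr scalerA; congr (_ *: _ + _).
  by apply/eqP; rewrite eq_complex /= !mul0r !mul1r sub0r add0r !eqxx.
rewrite !uD (uZc a b) (uZc (- b) a); apply/eqP; rewrite eq_complex /=.
by apply/andP; split; apply/eqP; ring.
Qed.

Context {X : normedModType R[i]}.

(** The norm takes values in [R[i]]; its real part is the [R]-valued functional to which the real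
    theorem applies. *)
Definition real_norm (x : X) : R := complex.Re `|x|.

Lemma real_normE (x : X) : `|x| = (real_norm x)%:C%C.
Proof. by rewrite /real_norm RRe_real// ger0_real. Qed.

Lemma real_norm_sublinear :
  sublinear (real_norm : restrict_scalars X -> R).
Proof.
split=> [x y|a x a0].
  by rewrite -lecR rmorphD /= -!real_normE ler_normD.
by rewrite -lecR rmorphM /= -!real_normE restrict_scalarsE normrZ
   ger0_norm ?lecR.
Qed.

Lemma complexification_bounded (u : restrict_scalars X -> R) :
  scalar u -> (forall x, u x <= real_norm x) ->
  bounded_op (complexification (u : X -> R) : X -> R[i]^o).
Proof.
move=> ul up; have uN (x : X) : u (- x) = - u x.
  have := ul (- 1) 0 0; rewrite scaler0 addr0 mulN1r addNr => u0.
  by have := ul (- 1) x 0; rewrite u0 !addr0 scaleN1r mulN1r.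
have up' (x : X) : `|u x| <= real_norm x.
  by rewrite ler_norml up andbT lerNl -uN (le_trans (up _))// /real_norm normrN.
(* Real and imaginary parts are each bounded by $\|x\|$, since $\|ix\| = \|x\|$. *)
exists 2 => x; rewrite [complexification _ _]complexE.
apply: le_trans (ler_normD _ _) _; rewrite normrM normc_i mul1r /=.
rewrite !normc_real.
have -> : 2 * `|x| = `|x| + `|'i%C *: x| :> R[i].
  by rewrite normrZ normc_i mul1r mulr_natl mulr2n.
by rewrite normrN !real_normE; apply: lerD; rewrite lecR.
Qed.

Theorem exists_dual_eq1 (z : X) : z != 0 -> exists k : dual X, k z = 1.
Proof.
move=> z0; have [u [ul up uz]] :=
  hahn_banach_support (z : restrict_scalars X) real_norm_sublinear.
have klin := complexification_linear ul.
have [M kM] := complexification_bounded ul up.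
pose k := complexification (u : X -> R).
have kz0 : k z != 0.
  apply/eqP => /(congr1 (@complex.Re R)) /=; rewrite uz => z_eq0.
  by move: z0; rewrite -normr_eq0 real_normE z_eq0 eqxx.
pose kL : {linear X -> R[i]^o} :=
  HB.pack (k : X -> R[i]^o)
    (GRing.isLinear.Build _ _ _ _ (k : X -> R[i]^o) klin).
pose kB : dual X := BoundedLinear (blfun := kL) (ex_intro _ M kM).
(* With second coefficient zero, [bl_lincomb] is multiplication by a scalar. *)
exists (bl_lincomb (k z)^-1 kB 0 kB).
by rewrite bl_lincombE scale0r addr0 /= [LHS]mulVf.
Qed.

End ComplexHahnBanach.

(** * Fixed points and operators of rank at most one *)

Section LinearAlgebra.
Context {K : fieldType} {V : lmodType K}.
Implicit Types (W : set V) (v w : V).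

Lemma lin_dep_colinear v w :
  lin_dep v w <-> (exists c : K, w = c *: v) \/ (exists c : K, v = c *: w).
Proof.
split=> [[a [b [ab0 vw0]]]|[[c ->]|[c ->]]].
- have [b0|b0] := eqVneq b 0; last first.
    left; exists (- (b^-1 * a)); move/eqP : vw0; rewrite addr_eq0 => /eqP vw0.
    by rewrite scaleNr -scalerA vw0 scalerN scalerK // opprK.
  have a0 : a != 0 by apply/eqP => a0; apply: ab0; rewrite a0 b0.
  right; exists 0; move: vw0; rewrite b0 !scale0r addr0 => /eqP.
  by rewrite scaler_eq0 (negbTE a0) => /eqP.
- exists c, (-1); split; last by rewrite scaleN1r subrr.
  by case=> _ /eqP; rewrite oppr_eq0 oner_eq0.
- exists (-1), c; split; last by rewrite scaleN1r addNr.
  by case=> /eqP; rewrite oppr_eq0 oner_eq0.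
Qed.

(** Since [dim] is a class of sets, this is how dimension zero is read off, and how equality of
    dimensions transfers it. *)
Lemma dim_set0 W : dim W set0 <-> W = [set 0].
Proof.
have span0 : lin_span (set0 : set V) = [set 0].
  apply/seteqP; split=> [_ [s [c [s0 ->]]]|_ ->]; last first.
    by exists [::], (fun=> 0); rewrite big_nil; split.
  by case: s s0 => [_|v s /(_ v (mem_head _ _))//]; rewrite big_nil.
split=> [[B [_ BW]]|->]; first by rewrite card_eq0 => /eqP B0; rewrite -BW B0.
exists set0; last exact: card_eqxx.
by split=> // s c _ s0 _ v /s0.
Qed.

Lemma dim_le1_colinear W : dim_le W 1 ->
  exists e, forall w, W w -> exists c : K, w = c *: e.
Proof.
case=> C [B [_ BW] BC] C1.
have B1 : (B #<= `I_1)%card by rewrite (card_le_eql BC).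
have [e Be] : exists e, B `<=` [set e].
  have [[e Be]|B0] := pselect (B !=set0); last first.
    by exists 0 => b Bb; case: B0; exists b.
  exists e => b Bb.
  move/pcard_leP : B1 => [f].
  apply: (@inj _ _ _ f); rewrite ?inE//.
  have fb : `I_1 (f b) by exact: funS.
  have fe : `I_1 (f e) by exact: funS.
  by move: fb fe; rewrite /= !ltnS !leqn0 => /eqP -> /eqP ->.
exists e => w; rewrite -BW => -[s [c [sB ->]]].
exists (\sum_(v <- s) c v); rewrite scaler_suml big_seq [RHS]big_seq.
by apply: eq_bigr => v vs; rewrite (Be v (sB v vs)).
Qed.

(** The basis is empty or any nonzero vector of [W]; [e] itself need not lie in [W]. *)
Lemma dim_le1_line W (e : V) : W 0 -> (forall (c : K) w, W w -> W (c *: w)) ->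
  (forall w, W w -> exists c : K, w = c *: e) -> dim_le W 1.
Proof.
move=> W0 WZ We.
have [WE|/eqP WN0] := eqVneq W [set 0].
  by exists set0; [exact/dim_set0|exact: card_ge0].
have [w Ww w0] : exists2 w, W w & w != 0.
  apply: contrapT => nW; apply: WN0; apply/seteqP; split=> [w Ww|_ ->//].
  by apply: contrapT => /eqP w0; apply: nW; exists w.
exists [set w]; last by rewrite (card_le_eql card_set1).
exists [set w]; last exact: card_eqxx.
split=> [s c us sw sum0 v vs|].
  move: sum0; rewrite (bigD1_seq v)//= big1_seq ?addr0; last first.
    by move=> u /andP[/eqP uv us']; case: uv; rewrite (sw u us') (sw v vs).
  move/eqP; rewrite scaler_eq0 (sw v vs) (negbTE w0) orbF.
  by move/eqP.
apply/seteqP; split=> [_ [s [c [sw ->]]]|u Wu].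
  suff -> : \sum_(v <- s) c v *: v = (\sum_(v <- s) c v) *: w by exact: WZ.
  rewrite scaler_suml big_seq [RHS]big_seq; apply: eq_bigr => v vs.
  by rewrite (sw v vs).
have [[c uE] [d wE]] := (We u Wu, We w Ww).
have d0 : d != 0 by apply: contraNneq w0 => d0; rewrite wE d0 scale0r.
exists [:: w], (fun=> c / d); split=> [v /=|]; first by rewrite inE => /eqP.
by rewrite big_seq1 wE scalerA divfK.
Qed.

End LinearAlgebra.

(** * The operators $x \otimes f$ and their fixed points *)

Section RankOne.
Context {K : numFieldType} {X : normedModType K}.
Implicit Types (A B C S T : 'B(X)) (x y z u : X) (f g h k : dual X).

Lemma dualZ f (c : K) u : f (c *: u) = c * f u.
Proof. exact: linearZ. Qed.

Lemma dualD f (c : K) u z : f (u + c *: z) = (f u : K) + c * f z.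
Proof. by rewrite linearD linearZ. Qed.

Lemma dualB f (c : K) u z : f (u - c *: z) = (f u : K) - c * f z.
Proof. by rewrite linearB linearZ. Qed.

Definition has_fix T A := fixedpts (bl_comp T A) <> [set 0].

Lemma fixedpts0 T : fixedpts T 0.
Proof. exact: linear0. Qed.

Lemma fixedptsZ T (c : K) x : fixedpts T x -> fixedpts T (c *: x).
Proof. by rewrite /fixedpts /= linearZ /= => ->. Qed.

(** A fixed point satisfies $f(z) Tx = z$; applying $f$ and cancelling $f(z) \ne 0$ gives the value
    1. Conversely, $Tx$ is a nonzero fixed point. *)
Lemma has_fix_rank1 T x f : has_fix T (rank1 x f) <-> f (T x) = 1.
Proof.
have fixE z : fixedpts (bl_comp T (rank1 x f)) z = ((f z : K) *: T x = z).
  by rewrite -linearZ.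
split=> [fixN0|fTx].
  have [z z0 zfix] : exists2 z, z != 0 & (f z : K) *: T x = z.
    apply: contrapT => nz; apply: fixN0; apply/seteqP; split=> [z|_ ->].
      rewrite fixE => zfix.
      by apply: contrapT => /eqP z0; apply: nz; exists z.
    exact: fixedpts0.
  have fz0 : (f z : K) != 0.
    by apply: contraNneq z0 => fz0; rewrite -zfix fz0 scale0r.
  apply: (mulfI fz0); rewrite mulr1.
  by have := congr1 f zfix; rewrite linearZ.
move=> fix0; have : fixedpts (bl_comp T (rank1 x f)) (T x).
  by rewrite fixE fTx scale1r.
rewrite fix0 /= => Tx0; move: fTx; rewrite Tx0 linear0 => /eqP.
by rewrite eq_sym oner_eq0.
Qed.

Lemma rank1_scale (c : K) x f g : (forall z, g z = c * f z) ->
  rank1 x g = rank1 (c *: x) f.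
Proof.
move=> gE; apply: bounded_linear_ext => z.
by rewrite /= /rank1_fun gE scalerA mulrC.
Qed.

(** The scalar relating two dependent factors moves to the other tensor factor, so they become
    equal. *)
Lemma op_sim_shared A B : op_sim A B ->
  (exists x f g, A = rank1 x f /\ B = rank1 x g) \/
  (exists x y f, A = rank1 x f /\ B = rank1 y f).
Proof.
have scaleE (c : K) f z : bl_lincomb c f 0 f z = c * f z.
  by rewrite bl_lincombE scale0r addr0.
case=> x [y [f [g [-> -> [/lin_dep_colinear|/lin_dep_colinear]]]]].
- move=> [[c ->]|[c ->]]; left; last exists y.
    by exists x, f, (bl_lincomb c g 0 g); rewrite (rank1_scale _ (scaleE _ _)).
  by exists (bl_lincomb c f 0 f), g; rewrite (rank1_scale _ (scaleE _ _)).
- move=> [[c gE]|[c fE]]; right.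
    exists x, (c *: y), f; split => //; apply: rank1_scale => z.
    by rewrite gE.
  exists (c *: x), y, g; split => //; apply: rank1_scale => z.
  by rewrite fE.
Qed.

Lemma rank_le1_rank1 x f : rank_le1 (rank1 x f).
Proof.
apply: (@dim_le1_line _ _ _ x).
- by exists 0 => //; exact: linear0.
- by move=> c _ [z _ <-]; exists (c *: z) => //; exact: linearZ.
- by move=> _ [z _ <-]; exists (f z).
Qed.

Lemma op_sim_midpoint A B : op_sim A B -> A <> B ->
  exists C, [/\ rank_le1 C, C <> A, C <> B &
    forall T, has_fix T A -> has_fix T B -> has_fix T C].
Proof.
move=> simAB AB.
have two0 : (2 : K) != 0 by rewrite pnatr_eq0.
have half : 2^-1 + 2^-1 = 1 :> K by field.
have midE (v w : X) : 2^-1 *: v + 2^-1 *: w = v -> v = w.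
  have vE : v = 2^-1 *: v + 2^-1 *: v by rewrite -scalerDl half scale1r.
  move=> e; have /addrI := etrans e vE.
  by move=> /(scalerI (invr_neq0 two0)).
have mid_neq C :
    (forall z, C z = 2^-1 *: A z + 2^-1 *: B z) -> C <> A /\ C <> B.
  move=> CE; split=> CAB; apply: AB; apply: bounded_linear_ext => z.
    by apply: midE; rewrite -CE CAB.
  by apply/esym/midE; rewrite addrC -CE CAB.
case: (op_sim_shared simAB) => [[x [f [g [AE BE]]]]|[x [y [f [AE BE]]]]].
- pose C := rank1 x (bl_lincomb 2^-1 f 2^-1 g).
  have [|CA CB] := mid_neq C.
    by move=> z; rewrite AE BE /= /rank1_fun /lincomb_fun scalerDl !scalerA.
  exists C; split => // [|T]; first exact: rank_le1_rank1.
  rewrite AE BE !has_fix_rank1 bl_lincombE => -> ->.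
  by rewrite -scalerDl half scale1r.
- pose C := rank1 (2^-1 *: x + 2^-1 *: y) f.
  have [|CA CB] := mid_neq C.
    move=> z; rewrite AE BE /= /rank1_fun scalerDr !scalerA.
    by congr (_ *: _ + _ *: _); rewrite mulrC.
  exists C; split => // [|T]; first exact: rank_le1_rank1.
  rewrite AE BE !has_fix_rank1 !linearD !linearZ /= => -> ->.
  by rewrite -scalerDl half scale1r.
Qed.

Hypothesis separating : forall x, x != 0 -> exists k, k x = 1.

Lemma rank_le1P A : rank_le1 A <-> exists x f, A = rank1 x f.
Proof.
split=> [/dim_le1_colinear[e Ae]|[x [f ->]]]; last exact: rank_le1_rank1.
have {}Ae z : exists c : K, A z = c *: e by apply: Ae; exists z.
have [e0|e0] := eqVneq e 0.
  have b0 : bounded_op (\0 : X -> K^o) by exists 0 => z; rewrite mul0r normr0.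
  exists 0, (BoundedLinear (blfun := \0) b0); apply: bounded_linear_ext => z.
  by have [c ->] := Ae z; rewrite e0 scaler0 /= /rank1_fun scaler0.
have [k ke] := separating e0.
(* As $k(e) = 1$ and $Az$ is a multiple of $e$, $Az = k(Az) e$. *)
exists e, (bl_comp k A); apply: bounded_linear_ext => z.
by have [c Az] := Ae z; rewrite /= /rank1_fun /= Az linearZ /= ke [_ *: 1]mulr1.
Qed.

(** Testing with $T = s^{-1} u \otimes k$, where $s = f(u) k(x) \ne 0$, gives $g(u) k(y) = s$. By
    symmetry the two products agree for all $u$, $k$, and functionals separate points. *)
Lemma rank1_has_fix_inj A B : rank_le1 A -> rank_le1 B ->
  (forall T, has_fix T A <-> has_fix T B) -> A = B.
Proof.
move=> /rank_le1P[x [f ->]] /rank_le1P[y [g ->]] AB.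
have rescale x1 f1 y1 g1 u k :
    (forall T, has_fix T (rank1 x1 f1) -> has_fix T (rank1 y1 g1)) ->
    (f1 u : K) * k x1 != 0 -> (g1 u : K) * k y1 = (f1 u : K) * k x1.
  move=> fg; set s := _ * _ => s0.
  have := fg (rank1 (s^-1 *: u) k); rewrite !has_fix_rank1 /= /rank1_fun.
  rewrite !linearZ /= => kfg.
  have {kfg} : (k y1 : K) * (s^-1 * g1 u) = 1.
    apply: kfg; rewrite [LHS]mulrCA.
    by rewrite [X in _ * X]mulrC mulVf.
  by rewrite mulrCA => /(canRL (mulVKf s0)); rewrite mulr1 mulrC.
have fg u k : (f u : K) * k x = g u * k y.
  have [fk0|fk0] := eqVneq ((f u : K) * k x) 0; last first.
    by apply/esym/rescale => // T /AB.
  have [gk0|gk0] := eqVneq ((g u : K) * k y) 0; first by rewrite fk0.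
  by apply: rescale => // T /AB.
apply: bounded_linear_ext => u; rewrite /= /rank1_fun.
apply/eqP; rewrite -subr_eq0; apply: contrapT => /negP /separating[k].
rewrite dualB dualZ => /eqP.
by rewrite fg subrr eq_sym oner_eq0.
Qed.

Lemma lin_dep_sym (V : lmodType K) (v w : V) : lin_dep v w -> lin_dep w v.
Proof.
by move=> /lin_dep_colinear vw; apply/lin_dep_colinear; case: vw; [right|left].
Qed.

Lemma exists_dual_01 x y : ~ lin_dep x y -> exists k, k x = 0 /\ k y = 1.
Proof.
move=> xy; have x0 : x != 0.
  apply/eqP => x0; apply: xy; apply/lin_dep_colinear; right; exists 0.
  by rewrite scale0r.
have [k kx] := separating x0.
have [|m mE] := @separating (y - (k y : K) *: x).
  rewrite subr_eq0; apply/eqP => yE; apply: xy; apply/lin_dep_colinear.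
  by left; exists (k y).
(* $m - m(x) k$ kills $x$ and takes at $y$ the value $m(y - k(y) x) = 1$. *)
exists (bl_lincomb 1 m (- (m x : K)) k).
rewrite !bl_lincombE !scale1r kx; split.
  by rewrite [_ *: 1]mulr1 subrr.
by rewrite -mE linearB linearZ /= scaleNr [_ *: k y]mulrC.
Qed.

Lemma exists_vec_01 f g : ~ lin_dep (f : X -> K^o) (g : X -> K^o) ->
  exists u, f u = 0 /\ g u = 1.
Proof.
move=> fg; have [a fa] : exists a, f a = 1.
  have [a fa] : exists a, (f a : K) != 0.
    apply: contrapT => f0; apply: fg; apply/lin_dep_colinear; right; exists 0.
    apply/funext => a; rewrite scale0r; apply: contrapT => /eqP fa.
    by apply: f0; exists a.
  by exists ((f a : K)^-1 *: a); rewrite linearZ /= [LHS]mulVf.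
(* If $g$ vanished at every $b - f(b) a$, which lies in $\ker f$, then $g = g(a) f$. *)
have [b gb] : exists b, (g b - (f b : K) * g a : K) != 0.
  apply: contrapT => g0; apply: fg; apply/lin_dep_colinear; left.
  exists (g a); apply/funext => b; apply: contrapT => /eqP gb.
  by apply: g0; exists b; rewrite subr_eq0 mulrC.
exists ((g b - (f b : K) * g a)^-1 *: (b - (f b : K) *: a)).
rewrite !dualZ !dualB fa mulr1 subrr mulr0; split => //.
exact: mulVf.
Qed.

(** Fixed points of $T (x \otimes f)$ lie on the line of $Tx$. Conversely, if $Au$ and $Av$ were
    independent, some $T$ would send them to $u$ and $v$; then $TA$ fixes both, which makes $u$, $v$
    and hence $Au$, $Av$ dependent. *)
Lemma rank_le1_fix A :
  rank_le1 A <-> forall T, dim_le (fixedpts (bl_comp T A)) 1.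
Proof.
split=> [/rank_le1P[x [f ->]] T|Afix].
  apply: (@dim_le1_line _ _ _ (T x)).
  - exact: fixedpts0.
  - by move=> c w; exact: fixedptsZ.
  - by move=> z zfix; exists (f z); rewrite -[LHS]zfix /= /rank1_fun linearZ.
have dep u v : lin_dep (A u) (A v).
  apply: contrapT => uv.
  have [k [ku kv]] := exists_dual_01 uv.
  have [m [mv mu]] := exists_dual_01 (fun vu => uv (lin_dep_sym vu)).
  pose T := bl_lincomb 1 (rank1 u m) 1 (rank1 v k).
  have [e Te] := dim_le1_colinear (Afix T).
  have [|a uE] := Te u.
    rewrite /fixedpts /= /lincomb_fun /= /rank1_fun.
    by rewrite mu ku scale0r !scale1r addr0.
  have [|b vE] := Te v.
    rewrite /fixedpts /= /lincomb_fun /= /rank1_fun.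
    by rewrite mv kv scale0r !scale1r add0r.
  have b0 : b != 0.
    apply/eqP => b0; apply: uv; apply/lin_dep_colinear; left; exists 0.
    by rewrite vE b0 !scale0r linear0.
  apply: uv; apply/lin_dep_colinear; right; exists (a / b).
  by rewrite -linearZ uE vE scalerA divfK.
have [[u Au]|A0] := pselect (exists u, A u != 0); last first.
  apply: (@dim_le1_line _ _ _ 0).
  - by exists 0 => //; exact: linear0.
  - by move=> c _ [z _ <-]; exists (c *: z) => //; exact: linearZ.
  - move=> _ [z _ <-]; exists 0; rewrite scaler0; apply: contrapT => /eqP Az.
    by apply: A0; exists z.
apply: (@dim_le1_line _ _ _ (A u)).
- by exists 0 => //; exact: linear0.
- by move=> c _ [z _ <-]; exists (c *: z) => //; exact: linearZ.
- move=> _ [z _ <-]; have /lin_dep_colinear[//|[c AuE]] := dep u z.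
  have c0 : c != 0 by apply: contraNneq Au => c0; rewrite AuE c0 scale0r.
  by exists c^-1; rewrite AuE scalerK.
Qed.

Lemma independent_rank1_has_fix x y z f g h :
    ~ lin_dep x y -> ~ lin_dep (f : X -> K^o) (g : X -> K^o) ->
    (forall T, has_fix T (rank1 x f) -> has_fix T (rank1 y g) ->
       has_fix T (rank1 z h)) ->
  rank1 z h = rank1 x f \/ rank1 z h = rank1 y g.
Proof.
move=> xy fg fixh.
have {}fixh T : f (T x) = 1 -> g (T y) = 1 -> h (T z) = 1.
  by rewrite -!has_fix_rank1; exact: fixh.
have [k2 [k2x k2y]] := exists_dual_01 xy.
have [k1 [k1y k1x]] := exists_dual_01 (fun yx => xy (lin_dep_sym yx)).
have [u2 [fu2 gu2]] := exists_vec_01 fg.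
have [u1 [gu1 fu1]] := exists_vec_01 (fun gf => fg (lin_dep_sym gf)).
have Rz k u v : rank1 u k v = (k v : K) *: u by [].
(* A base point in both $H$ sets, sending $x$ to [u1] and $y$ to [u2]; the conclusion comes from
   perturbing it by $u \otimes k$. *)
pose T0 := bl_lincomb 1 (rank1 u1 k1) 1 (rank1 u2 k2).
have T0x : T0 x = u1 by rewrite bl_lincombE !Rz k1x k2x !scale1r scale0r addr0.
have T0y : T0 y = u2 by rewrite bl_lincombE !Rz k1y k2y !scale1r scale0r add0r.
have hT0z : h (T0 z) = 1 by apply: fixh; rewrite ?T0x ?T0y.
have perturb u k :
    (k x : K) * f u = 0 -> (k y : K) * g u = 0 -> (k z : K) * h u = 0.
  move=> kfu kgu; have := fixh (bl_lincomb 1 T0 1 (rank1 u k)).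
  have TE w : bl_lincomb 1 T0 1 (rank1 u k) w = T0 w + (k w : K) *: u.
    by rewrite bl_lincombE !scale1r.
  rewrite !TE T0x T0y (dualD f) (dualD g) (dualD h) hT0z fu1 gu2 kfu kgu addr0.
  move=> /(_ erefl erefl) /eqP.
  by rewrite -subr_eq0 addrAC subrr add0r => /eqP.
have {}hT0z : (k1 z : K) * h u1 + (k2 z : K) * h u2 = 1.
  by rewrite -hT0z bl_lincombE !Rz !scale1r dualD dualZ.
have zE : z = (k1 z : K) *: x + (k2 z : K) *: y.
  apply/eqP; rewrite -subr_eq0 opprD addrA.
  apply: contrapT => /negP /separating[k]; rewrite !dualB => kz.
  (* Corrected to vanish at $x$ and $y$ while $k'(z) = 1$; [perturb] then forces $h = 0$. *)
  pose k' := bl_lincomb 1 (bl_lincomb 1 k (- (k x : K)) k1) (- (k y : K)) k2.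
  have k'E w : k' w = (k w : K) - k x * k1 w - k y * k2 w.
    by rewrite !bl_lincombE !scale1r !scaleNr.
  have k'x : k' x = 0 by rewrite k'E k1x k2x mulr1 mulr0 subrr subr0.
  have k'y : k' y = 0 by rewrite k'E k1y k2y mulr1 mulr0 subr0 subrr.
  have k'z : k' z = 1 by rewrite k'E -kz ![_ * k _]mulrC.
  have h0 u : h u = 0.
    have := @perturb u k'; rewrite k'x k'y k'z !mul0r mul1r.
    by move=> /(_ erefl erefl).
  by move/eqP: hT0z; rewrite !h0 !mulr0 addr0 eq_sym oner_eq0.
have hE u : h u = (f u : K) * h u1 + (g u : K) * h u2.
  (* The component of $u$ in $\ker f \cap \ker g$, on which [perturb] makes $h$ vanish. *)
  pose u' := u - (f u : K) *: u1 - (g u : K) *: u2.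
  have fu' : f u' = 0 by rewrite !dualB fu1 fu2 mulr1 mulr0 subrr subr0.
  have gu' : g u' = 0 by rewrite !dualB gu1 gu2 mulr1 mulr0 subr0 subrr.
  have hu' k : (k z : K) * h u' = 0 by apply: perturb; rewrite (fu', gu') mulr0.
  suff : h u' = 0.
    by rewrite !dualB -addrA -opprD => /eqP; rewrite subr_eq0 => /eqP.
  apply: contrapT => /eqP h0.
  have kz0 k : (k z : K) = 0.
    by have /eqP := hu' k; rewrite mulf_eq0 (negbTE h0) orbF => /eqP.
  by move/eqP: hT0z; rewrite !kz0 !mul0r addr0 eq_sym oner_eq0.
(* With $z = \alpha x + \beta y$ and $h = \gamma f + \delta g$, the cross terms $\alpha\delta$ and
   $\beta\gamma$ vanish, while $\alpha\gamma + \beta\delta = 1$; so $z \otimes h$ is one of the two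
   operators. *)
have h12 : (k1 z : K) * h u2 = 0.
  by apply: perturb; rewrite ?fu2 ?k1y (mulr0, mul0r).
have h21 : (k2 z : K) * h u1 = 0.
  by apply: perturb; rewrite ?gu1 ?k2x (mulr0, mul0r).
have [k1z|k1z] := eqVneq (k1 z : K) 0.
  move: hT0z; rewrite k1z mul0r add0r => hk2.
  have hu1 : (h u1 : K) = 0 by rewrite -[LHS]mul1r -hk2 mulrAC h21 mul0r.
  right; apply: bounded_linear_ext => u.
  by rewrite !Rz hE hu1 mulr0 add0r [in LHS]zE k1z scale0r add0r scalerA -mulrA
     [_ * k2 z]mulrC hk2 mulr1.
have hu2 : (h u2 : K) = 0.
  by move/eqP: h12; rewrite mulf_eq0 (negbTE k1z) => /eqP.
move: hT0z; rewrite hu2 mulr0 addr0 => hk1.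
have k2z : (k2 z : K) = 0 by rewrite -[LHS]mulr1 -hk1 mulrCA h21 mulr0.
left; apply: bounded_linear_ext => u.
by rewrite !Rz hE hu2 mulr0 addr0 [in LHS]zE k2z scale0r addr0 scalerA -mulrA
   [_ * k1 z]mulrC hk1 mulr1.
Qed.

(** The right-hand side uses only notions that transfer along [phi]. The case [A = B] is separate
    because the midpoint then equals [A]. *)
Lemma op_simP A B : rank_le1 A -> rank_le1 B ->
  op_sim A B <-> A = B \/ exists C, [/\ rank_le1 C, C <> A, C <> B &
    forall T, has_fix T A -> has_fix T B -> has_fix T C].
Proof.
move=> rA rB; split=> [simAB|].
  by have [->|AB] := pselect (A = B); [left|right; exact: op_sim_midpoint].
have /rank_le1P[x [f AE]] := rA; have /rank_le1P[y [g BE]] := rB.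
case=> [AB|[C [/rank_le1P[z [h CE]] CA CB fixC]]].
  exists x, x, f, f; split; rewrite -?AB//; left.
  by apply/lin_dep_colinear; left; exists 1; rewrite scale1r.
exists x, y, f, g; split=> //; apply: contrapT => /not_orP[xy fg].
have [] := @independent_rank1_has_fix x y z f g h xy fg.
- by rewrite -AE -BE -CE.
- by rewrite -AE -CE.
- by rewrite -BE -CE.
Qed.

End RankOne.

(** * Transfer along [phi] *)

Section FixedPointDimension.
Context {K : numFieldType} {X : normedModType K}.
Hypothesis separating : forall x : X, x != 0 -> exists k : dual X, k x = 1.
Variable phi : 'B(X) -> 'B(X).
Hypothesis phi_surj : forall S : 'B(X), exists T : 'B(X), phi T = S.
Hypothesis phi_fix : forall S T : 'B(X),
  dim (fixedpts (bl_comp S T)) = dim (fixedpts (bl_comp (phi S) (phi T))).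
Implicit Types A B C S T : 'B(X).

Lemma has_fix_map T A : has_fix T A <-> has_fix (phi T) (phi A).
Proof. by rewrite /has_fix -!dim_set0 phi_fix. Qed.

Lemma rank_le1_map A : rank_le1 A <-> rank_le1 (phi A).
Proof.
rewrite !(rank_le1_fix separating); split=> rA S.
  (* Surjectivity makes every test operator an image under [phi]. *)
  by have [T <-] := phi_surj S; rewrite /dim_le -phi_fix; exact: rA.
by rewrite /dim_le phi_fix; exact: rA.
Qed.

(** If [phi A = phi B], then [has_fix_map] gives $H A = H B$, which determines the operator. *)
Lemma rank_le1_map_inj A B : rank_le1 A -> rank_le1 B -> phi A = phi B -> A = B.
Proof.
move=> rA rB AB; apply: (rank1_has_fix_inj separating) => // T.
by rewrite has_fix_map AB -has_fix_map.
Qed.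

Lemma op_sim_map A B : rank_le1 A -> rank_le1 B ->
  op_sim A B <-> op_sim (phi A) (phi B).
Proof.
move=> rA rB.
have map_inj C D : rank_le1 C -> rank_le1 D -> C <> D -> phi C <> phi D.
  by move=> rC rD CD /rank_le1_map_inj => /(_ rC rD).
have [rphiA rphiB] := ((rank_le1_map A).1 rA, (rank_le1_map B).1 rB).
rewrite !(op_simP separating)//.
split=> -[AB|[C [rC CA CB fixC]]].
- by left; rewrite AB.
- right; exists (phi C); split; [exact: (rank_le1_map C).1|exact: map_inj..|].
  by move=> S; have [T <-] := phi_surj S; rewrite -!has_fix_map; exact: fixC.
- by left; exact: rank_le1_map_inj.
(* A preimage of the witness differs from [A] and [B] because its image differs from theirs. *)
right; have [D DC] := phi_surj C; subst C; exists D.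
split; [exact/(rank_le1_map D)|by move=> DA; apply: CA; rewrite DA
  |by move=> DB; apply: CB; rewrite DB|].
by move=> T /has_fix_map TA /has_fix_map TB; apply/has_fix_map/fixC.
Qed.

End FixedPointDimension.

Theorem lemma2p8 (R : realType) (X : completeNormedModType R[i])
  (Xinf : ~ finite_dim [set: X])
  (phi : 'B(X) -> 'B(X))
  (phi_surj : forall S : 'B(X), exists T : 'B(X), phi T = S)
  (phi_fix : forall S T : 'B(X),
     dim (fixedpts (bl_comp S T)) = dim (fixedpts (bl_comp (phi S) (phi T))))
  (A B : 'B(X)) (hA : rank_le1 A) (hB : rank_le1 B) :
  op_sim A B <-> op_sim (phi A) (phi B).
Proof.
exact: (op_sim_map (@exists_dual_eq1 R X) phi_surj phi_fix hA hB).
Qed.
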